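(* Let $U,\hat U\in\mathcal G_k\mathcal P_n$ be polynomial subspaces. Suppose that $W(\hat U)=g_1\cdot W(U)$ for some $g_1\in\mathrm{PSL}_2\mathbb C$. Then $U\sim\hat U$ if and only if there exists a projective transformation $g_2\in\mathrm{Stab}\,W(U)$ such that $\hat U=g_1\cdot (g_2\cdot U)$.
   Context: Work over $\mathbb C$. $\mathcal P_m$ is the vector space of polynomials in $z$ of degree $\le m$. Fix integers $n\ge 0$, $1\le k\le n+1$, and put $\ell=n+1-k$. $\mathcal G_k\mathcal P_n$ is the Grassmannian of $k$-dimensional subspaces of $\mathcal P_n$. For $g=\begin{pmatrix}a&b\\c&d\end{pmatrix}\in\mathrm{SL}_2\mathbb C$ and $p\in\mathcal P_m$, let $g\cdot p\in\mathcal P_m$ be the polynomial $(g\cdot p)(\hat z)=(c\hat z+d)^m\,p\!\left(\frac{a\hat z+b}{c\hat z+d}\right)$; for a subspace $U\subset\mathcal P_m$, $g\cdot U=\{g\cdot p:p\in U\}$. On subspaces this depends only on the class of $g$ in $\mathrm{PSL}_2\mathbb C=\mathrm{SL}_2\mathbb C/\{\pm I\}$. Write $U\sim\hat U$ (projectively equivalent) if $\hat U=h\cdot U$ for some $h\in\mathrm{PSL}_2\mathbb C$. For linearly independent $p_1,\dots,p_k\in\mathcal P_n$, the Wronskian $W(p_1,\dots,p_k)=\det(p_i^{(j-1)})_{1\le i,j\le k}$ is a nonzero element of $\mathcal P_{k\ell}$. For $U\in\mathcal G_k\mathcal P_n$ with basis $p_1,\dots,p_k$, $W(U)=\mathrm{span}\{W(p_1,\dots,p_k)\}\in\mathcal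 G_1\mathcal P_{k\ell}$. The action on $W(U)$ is the one on subspaces of $\mathcal P_{k\ell}$, and $\mathrm{Stab}\,W(U)=\{h\in\mathrm{PSL}_2\mathbb C: h\cdot W(U)=W(U)\}$. *)

(* Defs.v *)
From HB Require Import structures.
From mathcomp Require Import all_boot all_order all_algebra.
From mathcomp Require Import perm zify ring.
From mathcomp Require Import reals complex.

Set Implicit Arguments.
Unset Strict Implicit.
Unset Printing Implicit Defensive.
Import GRing.Theory.
Local Open Scope ring_scope.

(* {poly_n F} bounds the size, so polynomials of degree <= m have size <= m+1. *)
Notation polyspace F m := (npoly F (S m)).

(* (c z + d)^m p((a z + b) / (c z + d)), with the denominators cleared;
   see [mxact_horner]. *)
Definition mxact_poly (F : fieldType) (m : nat) (g : 'M[F]_2) (p : {poly F}) :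
    {poly F} :=
  \sum_(i < m.+1) p`_i *:
    ((g 0 0 *: 'X + (g 0 1)%:P) ^+ i * (g 1 0 *: 'X + (g 1 1)%:P) ^+ (m - i)).

Lemma size_affine_exp (F : fieldType) (a b : F) (i : nat) :
  (size ((a *: 'X + b%:P) ^+ i)%R <= i.+1)%N.
Proof.
apply: leq_trans (size_poly_exp_leq _ _) _; rewrite ltnS -{2}(mul1n i).
rewrite leq_mul2r; apply/orP; right.
have : (size (a *: 'X + b%:P)%R <= 2)%N.
  apply: leq_trans (size_polyD _ _) _; rewrite geq_max.
  rewrite (leq_trans (size_scale_leq _ _)) ?size_polyX //.
  by rewrite (leq_trans (size_polyC_leq1 _)).
by case: (size _) => [|[|[|]]].
Qed.

Lemma size_mxact (F : fieldType) (m : nat) (g : 'M[F]_2) (p : {poly F}) :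
  (size (mxact_poly m g p) <= m.+1)%N.
Proof.
apply: leq_trans (size_sum _ _ _) _; apply/bigmax_leqP => i _.
apply: leq_trans (size_scale_leq _ _) _.
apply: leq_trans (size_polyMleq _ _) _.
have := size_affine_exp (g 0 0) (g 0 1) i.
have := size_affine_exp (g 1 0) (g 1 1) (m - i).
have := ltn_ord i.
move: (size _) (size _) => x y; lia.
Qed.

Definition mxact (F : fieldType) (m : nat) (g : 'M[F]_2) (p : polyspace F m) :
    polyspace F m :=
  NPoly (size_mxact m g p).

Lemma mxact_horner (F : fieldType) (m : nat) (g : 'M[F]_2)
    (p : polyspace F m) (z : F) :
  g 1 0 * z + g 1 1 != 0 ->
  (mxact g p : {poly F}).[z] =
  (g 1 0 * z + g 1 1) ^+ m *
  (p : {poly F}).[(g 0 0 * z + g 0 1) / (g 1 0 * z + g 1 1)].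
Proof.
move=> nz; rewrite /= /mxact_poly horner_sum.
rewrite (horner_coef_wide _ (size_npoly p)) mulr_sumr.
apply: eq_bigr => i _.
rewrite !hornerE expr_div_n.
have im : (i <= m)%N by rewrite -ltnS.
rewrite -[in (_ + _) ^+ m](subnK im) exprD.
have w0 : (g 1 0 * z + g 1 1) ^+ i != 0 by rewrite expf_neq0.
move: ((_ + _) ^+ i) ((_ + _) ^+ (m - i)) ((_ + _) ^+ i) w0 => x y w w0.
by rewrite /=; field.
Qed.

Lemma mxact_is_linear (F : fieldType) (m : nat) (g : 'M[F]_2) :
  linear (@mxact F m g).
Proof.
move=> a p q; apply/val_inj; rewrite /= /mxact_poly scaler_sumr -big_split /=.
by apply: eq_bigr => i _; rewrite coefD coefZ scalerDl scalerA.
Qed.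

HB.instance Definition _ (F : fieldType) (m : nat) (g : 'M[F]_2) :=
  GRing.isLinear.Build F (polyspace F m) (polyspace F m) _ (@mxact F m g)
    (@mxact_is_linear F m g).

Lemma mxactN (F : fieldType) (m : nat) (g : 'M[F]_2) (p : polyspace F m) :
  mxact (- g) p = (-1) ^+ m *: mxact g p.
Proof.
apply/val_inj; rewrite /= /mxact_poly scaler_sumr; apply: eq_bigr => i _.
rewrite !mxE !polyCN !scaleNr -!opprD.
rewrite [in LHS]exprNn [X in _ * X]exprNn mulrACA -exprD.
rewrite subnKC; last by rewrite -ltnS.
rewrite scalerA [_ * p`_i]mulrC -scalerA; congr (_ *: _).
by rewrite -mul_polyC rmorphXn /= polyCN polyC1.
Qed.

Definition mxact_sub (F : fieldType) (m : nat) (g : 'M[F]_2)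
    (U : {vspace polyspace F m}) : {vspace polyspace F m} :=
  (linfun (@mxact F m g) @: U)%VS.

Lemma mxact_subN (F : fieldType) (m : nat) (g : 'M[F]_2)
    (U : {vspace polyspace F m}) :
  mxact_sub (- g) U = mxact_sub g U.
Proof.
have sub h : (mxact_sub (- h) U <= mxact_sub h U)%VS.
  apply/subvP => _ /memv_imgP[u uU ->].
  by rewrite lfunE /= mxactN memvZ // -[mxact h u]lfunE memv_img.
by apply: subv_anti; rewrite sub -{1}[g]opprK sub.
Qed.

Definition SL2 (F : fieldType) := {g : 'M[F]_2 | \det g == 1}.

Definition eq_sign (F : fieldType) : rel (SL2 F) :=
  fun g h => (val g == val h) || (val g == - val h).

Lemma eq_sign_refl (F : fieldType) : reflexive (@eq_sign F).
Proof. by move=> g; rewrite /eq_sign eqxx. Qed.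

Lemma eq_sign_sym (F : fieldType) : symmetric (@eq_sign F).
Proof.
by move=> g h; rewrite /eq_sign eq_sym [in X in _ || X]eq_sym eqr_oppLR.
Qed.

Lemma eq_sign_trans (F : fieldType) : transitive (@eq_sign F).
Proof.
move=> g h k; rewrite /eq_sign.
by case/orP=> /eqP-> /orP[]/eqP->; rewrite ?opprK eqxx ?orbT.
Qed.

Canonical eq_sign_equiv (F : fieldType) :=
  EquivRel (@eq_sign F) (@eq_sign_refl F) (@eq_sign_sym F) (@eq_sign_trans F).

Definition PSL2 (F : fieldType) := {eq_quot (@eq_sign F)}%qT.

(* Computed on a representative; [pact_pi] shows that the choice is immaterial. *)
Definition pact (F : fieldType) (m : nat) (g : PSL2 F)
    (U : {vspace polyspace F m}) : {vspace polyspace F m} :=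
  mxact_sub (val (repr g)) U.

Lemma pact_pi (F : fieldType) (m : nat) (g : SL2 F)
    (U : {vspace polyspace F m}) :
  pact (\pi_(PSL2 F) g)%qT U = mxact_sub (val g) U.
Proof.
rewrite /pact; have /eqmodP : (repr (\pi_(PSL2 F) g) = g %[mod PSL2 F])%qT.
  by rewrite reprK.
by case/orP => /eqP->; rewrite ?mxact_subN.
Qed.

Definition proj_equiv (F : fieldType) (m : nat)
    (U V : {vspace polyspace F m}) : Prop :=
  exists h : PSL2 F, V = pact h U.

Definition pstab (F : fieldType) (m : nat) (U : {vspace polyspace F m}) :
    pred (PSL2 F) :=
  [pred h | pact h U == U].

Definition wronskian (F : fieldType) (k : nat) (p : 'I_k -> {poly F}) :
    {poly F} :=
  \det (\matrix_(i < k, j < k) (p i)^`(j)).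

Lemma sum_uniq_bound (N : nat) (s : seq nat) :
  uniq s -> all (fun x => x < N)%N s ->
  (\sum_(x <- s) x <= \sum_(i < size s) i + size s * (N - size s))%N.
Proof.
elim: N s => [|N IH] s us sN.
  by case: s sN {us} => //= _; rewrite big_nil.
have [Ns|nNs] := boolP (N \in s).
  have ps := perm_to_rem Ns.
  rewrite (perm_big _ ps) big_cons (perm_size ps) /= big_ord_recr /=.
  have ur := rem_uniq N us.
  have /IH-/(_ ur) : all (fun x => x < N)%N (rem N s).
    apply/allP => x; rewrite mem_rem_uniq // inE => /andP[xN /(allP sN)].
    by rewrite ltnS leq_eqVlt (negPf xN).
  rewrite subSS mulSn => le_rem.
  rewrite [(N - _ + _)%N]addnC [leqRHS]addnACA addnC leq_add //.
  by rewrite -leq_subLR.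
have sN' : all (fun x => x < N)%N s.
  apply/allP => x xs; have := allP sN x xs.
  rewrite ltnS leq_eqVlt => /orP[/eqP e|//].
  by rewrite -e xs in nNs.
apply: leq_trans (IH _ us sN') _.
by rewrite leq_add2l leq_mul2l leq_sub2r ?orbT.
Qed.

Lemma size_wronskian_monomials (F : fieldType) (k n : nat)
    (f : {ffun 'I_k -> 'I_n.+1}) :
  (size (wronskian (fun i => 'X^(f i) : {poly F})) <= (k * (n.+1 - k)).+1)%N.
Proof.
have [/injectiveP injf|ninj] := boolP (injectiveb f); last first.
  have /injectivePn[i [j nij eij]] := ninj.
  rewrite /wronskian (determinant_alternate nij) ?size_poly0 // => l.
  by rewrite !mxE eij.
apply: leq_trans (size_sum _ _ _) _; apply/bigmax_leqP => s _.
rewrite -(rmorph_sign (@polyC F)) mul_polyC.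
apply: leq_trans (size_scale_leq _ _) _.
have [/existsP[i ltf]|/existsPn gef] := boolP [exists i, (f i < s i)%N].
  rewrite (bigD1 i) //= mxE derivnXn ffact_small // mulr0n mul0r size_poly0 //.
have -> : \prod_i (\matrix_(i, j) ('X^(f i))^`(j)) i (s i) =
    (\prod_i ((f i) ^_ (s i))%:R) *: 'X^(\sum_i (f i - s i)%N) :> {poly F}.
  rewrite -[in RHS]mul_polyC rmorph_prod -prodrXr -big_split /=.
  apply: eq_bigr => i _; rewrite mxE derivnXn -scaler_nat -mul_polyC //.
apply: leq_trans (size_scale_leq _ _) _; rewrite size_polyXn ltnS.
have e : (\sum_i f i = \sum_i (f i - s i) + \sum_(i < k) i)%N.
  rewrite [X in (_ + X)%N](reindex_inj (@perm_inj _ s)) -big_split /=.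
  by apply: eq_bigr => i _; rewrite subnK // leqNgt gef.
have := @sum_uniq_bound n.+1 [seq val (f i) | i <- enum 'I_k].
rewrite map_inj_uniq ?enum_uniq; last by move=> i j /val_inj/injf.
rewrite size_map size_enum_ord big_map big_enum => /(_ isT) /=.
have -> : all (fun x => x < n.+1)%N [seq val (f i) | i <- enum 'I_k].
  by apply/allP => _ /mapP[i _ ->]; exact: ltn_ord.
by rewrite (eq_bigl xpredT) // => /(_ isT); rewrite e addnC leq_add2l.
Qed.

Lemma wronskian_expand (F : fieldType) (k n : nat) (c : 'I_k -> 'I_n -> F)
    (q : 'I_n -> {poly F}) :
  wronskian (fun i => \sum_a c i a *: q a) =
  \sum_(f : {ffun 'I_k -> 'I_n}) (\prod_i c i (f i)) *: wronskian (q \o f).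
Proof.
rewrite /wronskian /determinant.
under [RHS]eq_bigr do rewrite scaler_sumr.
rewrite exchange_big /=; apply: eq_bigr => s _.
have -> : \prod_i (\matrix_(i, j) (\sum_a c i a *: q a)^`(j)) i (s i) =
    \prod_i \sum_a c i a *: (q a)^`(s i).
  apply: eq_bigr => i _; rewrite mxE raddf_sum /=.
  by apply: eq_bigr => a _; rewrite derivnZ.
rewrite bigA_distr_bigA mulr_sumr; apply: eq_bigr => f _.
rewrite scalerAr; congr (_ * _).
rewrite -mul_polyC rmorph_prod -big_split /=; apply: eq_bigr => i _.
by rewrite mxE mul_polyC.
Qed.

Lemma size_wronskian (F : fieldType) (k n : nat) (p : 'I_k -> polyspace F n) :
  (size (wronskian (fun i => p i : {poly F})) <= (k * (n.+1 - k)).+1)%N.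
Proof.
have -> : wronskian (fun i => p i : {poly F}) =
    wronskian (fun i => \sum_(a < n.+1) (p i)`_a *: 'X^a).
  congr (\det _); apply/matrixP => i j; rewrite !mxE; congr (_^`(_)).
  rewrite -poly_def; apply/polyP => l; rewrite coef_poly.
  by case: ltnP => // nl; rewrite nth_default // (leq_trans (size_npoly _)).
rewrite wronskian_expand.
apply: leq_trans (size_sum _ _ _) _; apply/bigmax_leqP => f _.
by apply: leq_trans (size_scale_leq _ _) _; exact: size_wronskian_monomials.
Qed.

Definition nwronskian (F : fieldType) (k n : nat) (p : 'I_k -> polyspace F n) :
    polyspace F (k * (n.+1 - k)) :=
  NPoly (size_wronskian p).

(* Meant for k = \dim U; then any basis of U gives the same line, see
   [wronskian_line_basis]. *)
Definition wronskian_line (F : fieldType) (k n : nat)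
    (U : {vspace polyspace F n}) : {vspace polyspace F (k * (n.+1 - k))} :=
  <[nwronskian (fun i : 'I_k => (vbasis U)`_i)]>%VS.

Lemma nwronskian_comb (F : fieldType) (k n : nat)
    (U : {vspace polyspace F n}) (b : k.-tuple (polyspace F n))
    (q : 'I_k -> polyspace F n) :
  basis_of U b -> (forall i, q i \in U) ->
  (nwronskian q \in <[nwronskian (fun i => b`_i)]>)%VS.
Proof.
move=> bU qU; apply/vlineP; exists (\det (\matrix_(i, j) coord b j (q i))).
apply/val_inj; rewrite /= /wronskian -mul_polyC -det_map_mx -det_mulmx.
congr (\det _); apply/matrixP => i j; rewrite !mxE.
rewrite [in LHS](coord_basis bU (qU i)) !raddf_sum /=.
by apply: eq_bigr => a _; rewrite !mxE linearZ mul_polyC.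
Qed.

Lemma wronskian_line_basis (F : fieldType) (k n : nat)
    (U : {vspace polyspace F n}) (b : k.-tuple (polyspace F n)) :
  basis_of U b ->
  wronskian_line k U = <[nwronskian (fun i => b`_i)]>%VS.
Proof.
move=> bU; have dU : \dim U = k by rewrite -(size_basis bU).
have mem (c : k.-tuple _) (cU : basis_of U c) (i : 'I_k) : c`_i \in U.
  by apply: (basis_mem cU); rewrite mem_nth ?size_tuple.
pose v := tcast dU (vbasis U).
have vE : v = vbasis U :> seq _ by rewrite val_tcast.
have vU : basis_of U v by rewrite vE vbasisP.
rewrite /wronskian_line -vE.
apply: subv_anti; apply/andP; split; rewrite -memvE.
  exact: (nwronskian_comb bU (mem _ vU)).
exact: (nwronskian_comb vU (mem _ bU)).
Qed.

(* Main.v *)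
Require Import Defs.
From HB Require Import structures.
From mathcomp Require Import all_boot all_order all_algebra.
From mathcomp Require Import perm zify ring.
From mathcomp Require Import reals complex.

Set Implicit Arguments.
Unset Strict Implicit.
Unset Printing Implicit Defensive.
Import GRing.Theory.
Local Open Scope ring_scope.

(** The theorem is a formal consequence of the equivariance of the Wronskian,
    W(g . U) = g . W(U).  If Uhat = h . U, take for g2 the transformation
    acting as h followed by the inverse of g1; it fixes W(U) because
    h . W(U) = W(Uhat) = g1 . W(U); conversely g1 . (g2 . -) is itself the
    action of an element of PSL2.  The substitution action is a right action,
    (g . (h . p)) = (h g) . p, so g2 is the class of the matrix product
    h g1^-1 in this order.

    For the equivariance, put u = a z + b, w = c z + d, so that the
    weight m action is p |-> w^m p(u/w).  It is multiplicative, weights adding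
    up ([mxact_polyM]), and when a d - b c = 1 it satisfies
      w (g ._m p)' = m c (g ._m p) + g ._(m-1) p'
    ([deriv_mxact_poly]).  Iterating this, w^j (g ._n p)^(j) is a combination
    of the g ._(n-s) p^(s) for s <= j, with constant coefficients depending
    on neither p nor z and leading coefficient 1 ([derivn_mxact_poly]).  This
    is a unitriangular change of columns in the Wronskian determinant, so
      w^(0 + 1 + ... + (k-1)) W(g ._n p_i) = det (g ._(n-s) p_i^(s)).
    In the Leibniz expansion of the right-hand side all terms have the same
    total weight, the sum of the n - s, and multiplicativity turns
    it into the action of g on W(p_i) in that weight; compared with the
    weight k (n + 1 - k) this brings out the same power of w, which cancels
    ([wronskian_mxact_poly]).  Nothing is
    divided by an integer, so the argument holds over any field. *)

(** * The action of a matrix on polynomials *)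

Definition mobius_num (F : fieldType) (g : 'M[F]_2) : {poly F} :=
  g 0 0 *: 'X + (g 0 1)%:P.

Definition mobius_den (F : fieldType) (g : 'M[F]_2) : {poly F} :=
  g 1 0 *: 'X + (g 1 1)%:P.

Lemma det_mx22 (F : fieldType) (g : 'M[F]_2) :
  \det g = g 0 0 * g 1 1 - g 0 1 * g 1 0.
Proof.
rewrite (expand_det_row _ 0) !big_ord_recl big_ord0 addr0 /cofactor !det_mx11.
rewrite !mxE /= expr0 mul1r expr1 mulN1r mulrN.
by congr (g _ _ * g _ _ - g _ _ * g _ _); apply/val_inj.
Qed.

Lemma poly_sum_widen (F : fieldType) (m : nat) (p : {poly F}) :
  (size p <= m.+1)%N -> p = \sum_(i < m.+1) p`_i *: 'X^i.
Proof.
move=> sp; rewrite -poly_def; apply/polyP => i; rewrite coef_poly.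
by case: ltnP => // mi; rewrite nth_default // (leq_trans sp).
Qed.

Lemma mxact_poly_is_linear (F : fieldType) (m : nat) (g : 'M[F]_2) :
  linear (mxact_poly m g).
Proof.
move=> a p q; rewrite /mxact_poly scaler_sumr -big_split /=.
by apply: eq_bigr => i _; rewrite coefD coefZ scalerDl scalerA.
Qed.

HB.instance Definition _ (F : fieldType) (m : nat) (g : 'M[F]_2) :=
  GRing.isLinear.Build F {poly F} {poly F} _ (mxact_poly m g)
    (@mxact_poly_is_linear F m g).

Lemma mxact_polyXn (F : fieldType) (m i : nat) (g : 'M[F]_2) :
  (i <= m)%N ->
  mxact_poly m g 'X^i = mobius_num g ^+ i * mobius_den g ^+ (m - i).
Proof.
move=> im; rewrite /mxact_poly -ltnS in im *.
rewrite (bigD1 (Ordinal im)) //= coefXn eqxx scale1r big1 ?addr0 // => j nj.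
rewrite coefXn; suff /negPf-> : (j : nat) != i by rewrite scale0r.
by apply: contraNneq nj => e; apply/eqP/val_inj.
Qed.

(** The factors w^m and w^m' clear the denominators of p and q separately; this
    is what lets every later computation avoid rational functions. *)
Lemma mxact_polyM (F : fieldType) (m m' : nat) (g : 'M[F]_2) (p q : {poly F}) :
  (size p <= m.+1)%N -> (size q <= m'.+1)%N ->
  mxact_poly (m + m') g (p * q) = mxact_poly m g p * mxact_poly m' g q.
Proof.
move=> /poly_sum_widen-> /poly_sum_widen->.
rewrite mulr_suml !linear_sum mulr_suml; apply: eq_bigr => i _.
rewrite mulr_sumr !linear_sum mulr_sumr; apply: eq_bigr => j _.
rewrite -scalerAl -scalerAr -exprD !linearZ /= -scalerAl -scalerAr.
have im : (i <= m)%N by rewrite -ltnS.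
have jm : (j <= m')%N by rewrite -ltnS.
rewrite !mxact_polyXn ?leq_add //.
have -> : (m + m' - (i + j) = (m - i) + (m' - j))%N by lia.
by rewrite !exprD mulrACA.
Qed.

Lemma mxact_poly1 (F : fieldType) (m : nat) (g : 'M[F]_2) :
  mxact_poly m g 1 = mobius_den g ^+ m.
Proof. by rewrite -(expr0 'X) mxact_polyXn // expr0 mul1r subn0. Qed.

(** Raising the weight only multiplies by a power of the denominator: view p as
    the product of the constant 1, of weight e, with p. *)
Lemma mxact_poly_raise (F : fieldType) (m e : nat) (g : 'M[F]_2)
    (p : {poly F}) :
  (size p <= m.+1)%N ->
  mxact_poly (e + m) g p = mobius_den g ^+ e * mxact_poly m g p.
Proof.
by move=> sp; rewrite -{1}[p]mul1r mxact_polyM ?mxact_poly1 ?size_poly1.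
Qed.

Lemma size_prod_weights (F : fieldType) (I : Type) (r : seq I) (m : I -> nat)
    (p : I -> {poly F}) :
  (forall i, size (p i) <= (m i).+1)%N ->
  (size (\prod_(i <- r) p i)%R <= (\sum_(i <- r) m i).+1)%N.
Proof.
move=> sp; elim: r => [|i r IH]; rewrite ?big_nil ?size_poly1 // !big_cons.
apply: leq_trans (size_polyMleq _ _) _.
by have := sp i; move: (size _) (size _) IH => x y; lia.
Qed.

Lemma mxact_poly_prod (F : fieldType) (I : Type) (r : seq I) (m : I -> nat)
    (g : 'M[F]_2) (p : I -> {poly F}) :
  (forall i, size (p i) <= (m i).+1)%N ->
  mxact_poly (\sum_(i <- r) m i) g (\prod_(i <- r) p i) =
  \prod_(i <- r) mxact_poly (m i) g (p i).
Proof.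
move=> sp; elim: r => [|i r IH]; rewrite ?big_nil ?mxact_poly1 ?expr0 //.
by rewrite !big_cons mxact_polyM ?IH // size_prod_weights.
Qed.

Lemma mxact_polyX (F : fieldType) (m i : nat) (g : 'M[F]_2) (p : {poly F}) :
  (size p <= m.+1)%N ->
  mxact_poly (i * m) g (p ^+ i) = mxact_poly m g p ^+ i.
Proof.
move=> sp; have := @mxact_poly_prod F 'I_i (index_enum _) (fun=> m) g (fun=> p).
by rewrite !prodr_const sum_nat_const card_ord; apply.
Qed.

Lemma mxact_poly_affine (F : fieldType) (g : 'M[F]_2) (a b : F) :
  mxact_poly 1 g (a *: 'X + b%:P) = a *: mobius_num g + b *: mobius_den g.
Proof.
rewrite linearD linearZ -[b%:P]alg_polyC linearZ /= mxact_poly1 expr1.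
by rewrite -['X]expr1 mxact_polyXn // expr1 mulr1.
Qed.

(** The order is reversed because substitution acts on the right.  By
    multiplicativity it is enough to transform the two affine forms of h, on
    which g acts by the matrix product. *)
Lemma mxact_poly_comp (F : fieldType) (m : nat) (g h : 'M[F]_2)
    (p : {poly F}) :
  mxact_poly m g (mxact_poly m h p) = mxact_poly m (h *m g) p.
Proof.
rewrite {2 3}/mxact_poly linear_sum; apply: eq_bigr => i _.
rewrite linearZ /=; congr (_ *: _).
have im : (i <= m)%N by rewrite -ltnS.
have s1 (a b : F) : (size (a *: 'X + b%:P)%R <= 2)%N.
  by have := size_affine_exp a b 1; rewrite expr1.
have row j : (h *m g) j 0 *: 'X + ((h *m g) j 1)%:P =
    mxact_poly 1 g (h j 0 *: 'X + (h j 1)%:P).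
  rewrite mxact_poly_affine /mobius_num /mobius_den !mxE.
  rewrite !big_ord_recl !big_ord0 !addr0.
  rewrite -!mul_polyC !polyCD !polyCM.
  have -> : lift ord0 ord0 = 1 :> 'I_2 by apply/val_inj.
  by ring.
rewrite !row -!mxact_polyX // !muln1 -mxact_polyM ?size_affine_exp //.
by rewrite subnKC.
Qed.

Lemma mxact_poly_id (F : fieldType) (m : nat) (p : {poly F}) :
  (size p <= m.+1)%N -> mxact_poly m 1%:M p = p.
Proof.
move=> sp; rewrite [RHS](poly_sum_widen sp); apply: eq_bigr => i _.
by rewrite !mxE /= scale1r addr0 scale0r add0r expr1n mulr1.
Qed.

(** * Derivatives and the action *)

(** The derivative of u/w is (a d - b c) / w^2 = 1 / w^2, so differentiating
    w^m p(u/w) and multiplying by w gives m c w^m p(u/w) + w^(m-1) p'(u/w).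
    On the monomial u^i w^(m-i) this is the identity a w - c u = 1.  For
    m = 0 the truncated weight does no harm since then p' = 0. *)
Lemma deriv_mxact_poly (F : fieldType) (m : nat) (g : 'M[F]_2) (p : {poly F}) :
  \det g = 1 -> (size p <= m.+1)%N ->
  mobius_den g * (mxact_poly m g p)^`() =
  (m%:R * g 1 0) *: mxact_poly m g p + mxact_poly m.-1 g p^`().
Proof.
move=> dg sp.
have E : mxact_poly m g p =
    \sum_(i < m.+1) p`_i *: (mobius_num g ^+ i * mobius_den g ^+ (m - i)) by [].
have E' : mxact_poly m.-1 g p^`() =
    \sum_(i < m.+1) p`_i *: mxact_poly m.-1 g ('X^i)^`().
  rewrite {1}(poly_sum_widen sp) raddf_sum (raddf_sum (mxact_poly m.-1 g)) /=.
  by apply: eq_bigr => i _; rewrite derivZ linearZ.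
rewrite {}E {}E' raddf_sum mulr_sumr scaler_sumr -big_split /=.
apply: eq_bigr => i _; rewrite derivZ -scalerAr scalerA.
rewrite [_ * p`_i]mulrC -scalerA -scalerDr; congr (_ *: _).
have : (i <= m)%N by rewrite -ltnS.
move: (nat_of_ord i) => {}i im.
have du : (mobius_num g)^`() = (g 0 0)%:P.
  by rewrite /mobius_num derivD derivZ derivX derivC addr0 alg_polyC.
have dw : (mobius_den g)^`() = (g 1 0)%:P.
  by rewrite /mobius_den derivD derivZ derivX derivC addr0 alg_polyC.
have det1 : (g 0 0)%:P * mobius_den g - (g 1 0)%:P * mobius_num g = 1.
  transitivity (\det g)%:P; last by rewrite dg.
  rewrite det_mx22 /mobius_num /mobius_den.
  by rewrite -!mul_polyC polyCB !polyCM; ring.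
have powS v e : v * (v ^+ e.-1 *+ e) = v ^+ e *+ e :> {poly F}.
  by case: e => [|e]; rewrite ?mulr0n ?mulr0 // mulrnAr -exprS.
have actX : mxact_poly m.-1 g ('X^i)^`() =
    (mobius_num g ^+ i.-1 *+ i) * mobius_den g ^+ (m - i).
  rewrite derivXn linearMn mulrnAl; case: i im => [|i] im //=.
  by rewrite mxact_polyXn; first (congr (_ * _ ^+ _ *+ _)); lia.
rewrite actX derivM !deriv_exp du dw -2!mulrnAr.
have -> : m%:R = i%:R + (m - i)%:R :> F by rewrite -natrD subnKC.
have Hu := powS (mobius_num g) i; have Hw := powS (mobius_den g) (m - i)%N.
rewrite -[_ ^+ i *+ i]mulr_natr in Hu.
rewrite -[_ ^+ (m - i) *+ _]mulr_natr in Hw.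
rewrite -mul_polyC polyCM polyCD !polyC_natr.
move: (mobius_num g ^+ i.-1 *+ i) Hu => X Hu.
move: (mobius_den g ^+ (m - i).-1 *+ (m - i)) Hw => Y Hw.
move: (mobius_num g ^+ i) (mobius_den g ^+ (m - i)) Hu Hw => A B Hu Hw.
transitivity ((g 0 0)%:P * mobius_den g * X * B +
   (g 1 0)%:P * A * (mobius_den g * Y)); first by ring.
rewrite Hw.
transitivity ((g 1 0)%:P * (A * i%:R) * B + (g 1 0)%:P * A * B * (m - i)%:R
   + X * B); last by ring.
rewrite -Hu -[X in _ + X * B]mul1r -det1; ring.
Qed.

(** The coefficient of g ._(n-s) p^(s) in w^j (g ._n p)^(j).  With D_j for the
    latter, the recursion is D_(j+1) = w D_j' - j c D_j combined with
    [deriv_mxact_poly] for the derivatives of the terms of D_j. *)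
Fixpoint gauge_coef (F : fieldType) (n : nat) (c : F) (j s : nat) : F :=
  if j is j'.+1 then
    ((n - s)%:R - j'%:R) * c * gauge_coef n c j' s +
    (if s is s'.+1 then gauge_coef n c j' s' else 0)
  else (s == 0)%:R.

Lemma gauge_coef_gt (F : fieldType) (n : nat) (c : F) (j s : nat) :
  (j < s)%N -> gauge_coef n c j s = 0.
Proof.
elim: j s => [|j IH] [|s] //= js.
by rewrite !IH ?mulr0 ?addr0 // ltnW.
Qed.

Lemma gauge_coef_diag (F : fieldType) (n : nat) (c : F) (j : nat) :
  gauge_coef n c j j = 1.
Proof.
by elim: j => [|j IH] //=; rewrite gauge_coef_gt // mulr0 add0r.
Qed.

Lemma size_derivn_npoly (F : fieldType) (n s : nat) (p : {poly F}) :
  (size p <= n.+1)%N -> (size p^`(s) <= (n - s).+1)%N.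
Proof.
move=> sp; elim: s => [|s IH]; first by rewrite derivn0 subn0.
rewrite derivnS; have [->|nz] := eqVneq p^`(s) 0.
  by rewrite deriv0 size_poly0.
by have := lt_size_deriv nz; move: IH; move: (size _) (size _) => x y; lia.
Qed.

(** The bound K on the range of s is free because the coefficients vanish for
    s > j; with K = k all columns j < k of a Wronskian matrix are expressed
    through one and the same set of columns. *)
Lemma derivn_mxact_poly (F : fieldType) (n j K : nat) (g : 'M[F]_2)
    (p : {poly F}) :
  \det g = 1 -> (size p <= n.+1)%N -> (j < K)%N ->
  mobius_den g ^+ j * (mxact_poly n g p)^`(j) =
  \sum_(s < K) gauge_coef n (g 1 0) j s *: mxact_poly (n - s) g p^`(s).
Proof.
move=> dg sp; elim: j K => [|j IH] K jK.
  case: K jK => // K _; rewrite big_ord_recl.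
  rewrite big1 => [|i _]; last by rewrite scale0r.
  by rewrite scale1r expr0 mul1r addr0 !derivn0 subn0.
have dw : (mobius_den g)^`() = (g 1 0)%:P.
  by rewrite /mobius_den derivD derivZ derivX derivC addr0 alg_polyC.
have wj : mobius_den g * (mobius_den g ^+ j)^`() =
    (j%:R * g 1 0)%:P * mobius_den g ^+ j.
  rewrite deriv_exp dw polyCM polyC_natr; case: (j) => [|e].
    by rewrite mulr0n !mul0r mulr0.
  by rewrite exprS -mulr_natr /=; ring.
have step : mobius_den g ^+ j.+1 * (mxact_poly n g p)^`(j.+1) =
    mobius_den g * (mobius_den g ^+ j * (mxact_poly n g p)^`(j))^`()
    - (j%:R * g 1 0) *: (mobius_den g ^+ j * (mxact_poly n g p)^`(j)).
  rewrite derivM mulrDr mulrA wj derivnS exprS -mul_polyC; ring.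
case: K jK => // K; rewrite ltnS => jK.
rewrite step (IH K.+1 (ltnW jK)) raddf_sum mulr_sumr scaler_sumr -sumrB /=.
pose A s := mxact_poly (n - s) g p^`(s).
transitivity (\sum_(s < K.+1)
    ((((n - s)%:R - j%:R) * g 1 0 * gauge_coef n (g 1 0) j s) *: A s +
     gauge_coef n (g 1 0) j s *: A s.+1)).
  apply: eq_bigr => s _; rewrite derivZ -scalerAr.
  rewrite deriv_mxact_poly ?size_derivn_npoly // -derivnS -subnS /A.
  rewrite scalerDr !scalerA addrAC -scalerBl; congr (_ *: _ + _); ring.
rewrite big_split /= [X in _ + X]big_ord_recr /= gauge_coef_gt // scale0r addr0.
under [RHS]eq_bigr do rewrite scalerDl.
by rewrite big_split /= [X in _ = _ + X]big_ord_recl /= scale0r add0r.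
Qed.

(** * Equivariance of the Wronskian *)

(** Both sides are compared after multiplication by w^e, e = 0 + ... + (k-1):
    this is the factor needed to make the derivatives on the left constant
    combinations of the g ._(n-s) p_i^(s), and also the gap between the weight
    k (n + 1 - k) and the total weight of a Leibniz term. *)
Lemma wronskian_mxact_poly (F : fieldType) (k n : nat) (g : 'M[F]_2)
    (p : 'I_k -> {poly F}) :
  \det g = 1 -> (k <= n.+1)%N -> (forall i, size (p i) <= n.+1)%N ->
  (size (wronskian p) <= (k * (n.+1 - k)).+1)%N ->
  wronskian (fun i => mxact_poly n g (p i)) =
  mxact_poly (k * (n.+1 - k)) g (wronskian p).
Proof.
move=> dg kn sp sW.
have den0 : mobius_den g != 0.
  apply/eqP => den0.
  have := dg; rewrite det_mx22.
  have := congr1 (fun q : {poly F} => q`_0) den0.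
  have := congr1 (fun q : {poly F} => q`_1) den0.
  rewrite /mobius_den !coefD !coefZ !coefX !coefC /= !mulr0 mulr1 addr0 add0r.
  by move=> -> ->; rewrite !mulr0 subr0 => /eqP; rewrite eq_sym oner_eq0.
pose w := mobius_den g; pose e := (\sum_(i < k) i)%N.
apply: (@mulfI _ (w ^+ e)); first by rewrite expf_neq0.
pose A := \matrix_(i < k, s < k) mxact_poly (n - s) g (p i)^`(s).
transitivity (\det A).
  transitivity (\det ((\matrix_(i, j) (mxact_poly n g (p i))^`(j)) *m
      diag_mx (\row_(j < k) w ^+ j))).
    rewrite det_mulmx det_diag mulrC; congr (_ * _).
    by rewrite -prodrXr; apply: eq_bigr => i _; rewrite mxE.
  pose C := \matrix_(j < k, s < k) (gauge_coef n (g 1 0) j s)%:P.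
  have dC : \det C = 1.
    rewrite det_trig; last first.
      by apply/is_trig_mxP => i j ij; rewrite mxE gauge_coef_gt.
    by rewrite big1 // => i _; rewrite mxE gauge_coef_diag.
  rewrite -[RHS]mulr1 -dC -(det_tr C) -det_mulmx; congr (\det _).
  apply/matrixP => i j; rewrite mul_mx_diag !mxE mulrC.
  rewrite (@derivn_mxact_poly _ _ _ k) //; apply: eq_bigr => s _.
  by rewrite !mxE mulrC mul_polyC.
rewrite -mxact_poly_raise // /wronskian /determinant linear_sum.
apply: eq_bigr => s _ /=.
rewrite -!(rmorph_sign (@polyC F)) !mul_polyC linearZ /=; congr (_ *: _).
have weight : (e + k * (n.+1 - k) = \sum_(i < k) (n - s i))%N.
  (* Reversing the order of the columns pairs n - (k-1-i) with i + (n+1-k). *)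
  transitivity (\sum_(i < k) (n - i))%N; last exact: (reindex_inj (@perm_inj _ s)).
  rewrite (reindex_inj rev_ord_inj).
  have -> : (k * (n.+1 - k) = \sum_(i < k) (n.+1 - k))%N.
    by rewrite sum_nat_const card_ord.
  by rewrite -big_split; apply: eq_bigr => i _ /=; have := ltn_ord i; lia.
under eq_bigr do rewrite mxE.
under [in RHS]eq_bigr do rewrite mxE.
rewrite weight mxact_poly_prod // => i; exact: size_derivn_npoly.
Qed.

(** * The action on subspaces *)

Lemma mxact_comp (F : fieldType) (m : nat) (g h : 'M[F]_2)
    (p : polyspace F m) :
  mxact g (mxact h p) = mxact (h *m g) p.
Proof. by apply/val_inj; rewrite /= mxact_poly_comp. Qed.

Lemma mxact1 (F : fieldType) (m : nat) (p : polyspace F m) :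
  mxact 1%:M p = p.
Proof. by apply/val_inj; rewrite /= mxact_poly_id ?size_npoly. Qed.

Lemma mxact_sub_comp (F : fieldType) (m : nat) (g h : 'M[F]_2)
    (U : {vspace polyspace F m}) :
  mxact_sub g (mxact_sub h U) = mxact_sub (h *m g) U.
Proof.
rewrite /mxact_sub -limg_comp; congr (_ @: _)%VS.
by apply/lfunP => p; rewrite comp_lfunE !lfunE /= mxact_comp.
Qed.

Lemma mxact_sub1 (F : fieldType) (m : nat) (U : {vspace polyspace F m}) :
  mxact_sub 1%:M U = U.
Proof.
rewrite /mxact_sub -[RHS]lim1g; congr (_ @: _)%VS.
by apply/lfunP => p; rewrite !lfunE /= mxact1.
Qed.

(** A matrix of determinant 1 acts injectively, hence carries a basis of U to a
    basis of g . U, and either basis may be used to compute the line. *)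
Lemma wronskian_line_mxact (F : fieldType) (k n : nat) (g : 'M[F]_2)
    (U : {vspace polyspace F n}) :
  \det g = 1 -> (k <= n.+1)%N -> \dim U = k ->
  wronskian_line k (mxact_sub g U) = mxact_sub g (wronskian_line k U).
Proof.
move=> dg kn dU.
have inj : lker (linfun (@mxact F n g)) == 0%VS.
  apply/lker0P; apply: (can_inj (g := mxact (invmx g))) => p.
  by rewrite lfunE /= mxact_comp mulmxV ?mxact1 // unitmxE dg unitr1.
pose b := tcast dU (vbasis U).
have bU : basis_of U b by rewrite val_tcast vbasisP.
have gbU : basis_of (mxact_sub g U) [tuple of map (linfun (mxact g)) b].
  by apply: limg_basis_of bU; rewrite (eqP inj) capv0.
rewrite (wronskian_line_basis gbU) (wronskian_line_basis bU) /mxact_sub limg_line.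
congr <[_]>%VS; apply/val_inj; rewrite lfunE /=.
have sb (i : 'I_k) : (size ((b`_i)%R : {poly F}) <= n.+1)%N by exact: size_npoly.
have sW := size_wronskian (fun i : 'I_k => b`_i).
rewrite -(wronskian_mxact_poly dg kn sb sW).
congr (\det _); apply/matrixP => i j; rewrite !mxE; congr (_^`(_)).
by rewrite (nth_map 0) ?size_tuple // lfunE.
Qed.

Theorem theorem5p4 (R : realType) (n k : nat) (hk : (1 <= k <= n.+1)%N)
    (U Uhat : {vspace polyspace R[i] n})
    (hU : \dim U = k) (hUhat : \dim Uhat = k)
    (g1 : PSL2 R[i])
    (hW : wronskian_line k Uhat = pact g1 (wronskian_line k U)) :
  proj_equiv U Uhat <->
  exists2 g2 : PSL2 R[i],
    g2 \in pstab (wronskian_line k U) & Uhat = pact g1 (pact g2 U).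
Proof.
have /andP[_ kn] := hk.
set G1 := val (repr g1); have dG1 : \det G1 = 1 by apply/eqP/(valP (repr g1)).
have uG1 : G1 \in unitmx by rewrite unitmxE dG1 unitr1.
split=> [[h hE]|[g2 _ ->]].
  set H := val (repr h) in hE; have dH : \det H = 1 by apply/eqP/(valP (repr h)).
  (* In a right action the factor applied first stands on the left. *)
  have dg2 : \det (H *m invmx G1) == 1.
    by rewrite det_mulmx det_inv dG1 dH invr1 mulr1.
  pose g2 : SL2 R[i] := exist _ (H *m invmx G1) dg2.
  exists (\pi_(PSL2 R[i]) g2)%qT; last first.
    by rewrite pact_pi /pact mxact_sub_comp -/G1 /= mulmxKV.
  rewrite inE pact_pi /= -mxact_sub_comp -wronskian_line_mxact //.
  rewrite -[mxact_sub H U]hE hW /pact mxact_sub_comp -/G1.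
  by rewrite mulmxV // mxact_sub1.
rewrite /pact mxact_sub_comp; set A := _ *m _.
have dA : \det A == 1.
  by rewrite det_mulmx dG1 mulr1; apply: (valP (repr g2)).
by exists (\pi_(PSL2 R[i]) (exist _ A dA : SL2 R[i]))%qT; rewrite pact_pi.
Qed.
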